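(* Let $(X,T)$ be a minimal distal topological dynamical system, and let $\mathsf P\subset X^4$ and $\mathsf Q\subset X^8$ be its sets of dynamical parallelograms and parallelepipeds. Then $(\mathsf P,\mathsf Q)$ is a parallelepiped structure on $X$.
   Context: A system $(X,T)$ is a compact metrizable space $X$ (with a compatible distance $d$) together with a homeomorphism $T\colon X\to X$. It is minimal if every orbit $\{T^nx:n\in\mathbb Z\}$ is dense, and distal if $\inf_{n\in\mathbb Z}d(T^nx,T^ny)>0$ for all $x\neq y$. $\mathsf P$ is the closure in $X^4$ of $\{(x,T^mx,T^nx,T^{m+n}x): x\in X,\ m,n\in\mathbb Z\}$, and $\mathsf Q$ is the closure in $X^8$ of $\{(x,T^mx,T^nx,T^{m+n}x,T^px,T^{m+p}x,T^{n+p}x,T^{m+n+p}x): x\in X,\ m,n,p\in\mathbb Z\}$. Parallelepiped structure (in the sense of Host and Kra). Let $X$ be a nonempty set. A parallelogram structure on $X$ is a subset $\mathsf P\subset X^4$ such that: (a) the relation on $X^2$ given by $(x_0,x_1)\sim(x_2,x_3)$ iff $(x_0,x_1,x_2,x_3)\in\mathsf P$ is an equivalence relation; (b) if $(x_0,x_1,x_2,x_3)\in\mathsf P$ then $(x_0,x_2,x_1,x_3)\in\mathsf P$; (c) for all $x_0,x_1,x_2\in X$ there exists $x_3\in X$ with $(x_0,x_1,x_2,x_3)\in\mathsf P$. A parallelepiped structure on $X$ is a pair $(\mathsf P,\mathsf Q)$ where $\mathsf P$ is a parallelogram structure on $X$ and $\mathsf Q\subset X^8$ satisfies: (i) for every $(x_0,\dots,x_7)\in\mathsf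 Q$, all faces $(x_0,x_1,x_2,x_3)$, $(x_4,x_5,x_6,x_7)$, $(x_0,x_1,x_4,x_5)$, $(x_2,x_3,x_6,x_7)$, $(x_0,x_2,x_4,x_6)$, $(x_1,x_3,x_5,x_7)$ belong to $\mathsf P$; (ii) $\mathsf Q$ is invariant under all Euclidean permutations of the cube, i.e. permutations of the coordinates induced by isometries of the unit cube, where index $i=\varepsilon_1+2\varepsilon_2+4\varepsilon_3$ corresponds to the vertex $(\varepsilon_1,\varepsilon_2,\varepsilon_3)\in\{0,1\}^3$; (iii) identifying $X^8$ with $X^4\times X^4$, the relation $\mathbf x\approx\mathbf y$ iff $(\mathbf x,\mathbf y)\in\mathsf Q$ is an equivalence relation on $\mathsf P$; (iv) if $x_0,\dots,x_6\in X$ are such that $(x_0,x_1,x_2,x_3)$, $(x_0,x_1,x_4,x_5)$ and $(x_0,x_2,x_4,x_6)$ belong to $\mathsf P$, then there exists $x_7\in X$ with $(x_0,\dots,x_7)\in\mathsf Q$. *)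

(* Defs.v *)
From mathcomp Require Import all_boot all_order all_fingroup all_algebra.
From mathcomp Require Import all_classical all_reals all_analysis.

Set Implicit Arguments.
Unset Strict Implicit.
Unset Printing Implicit Defensive.

Import Order.TTheory GRing.Theory Num.Theory.

Local Open Scope classical_set_scope.
Local Open Scope ring_scope.

Record homeo (X : topologicalType) := Homeo {
  homeo_fun :> X -> X ;
  homeo_inv : X -> X ;
  homeoK : cancel homeo_fun homeo_inv ;
  homeoVK : cancel homeo_inv homeo_fun ;
  homeo_continuous : continuous homeo_fun ;
  homeo_inv_continuous : continuous homeo_inv }.

(* [Negz k] is the integer - (k + 1). *)
Definition hpow (X : topologicalType) (T : homeo X) (n : int) : X -> X :=
  match n with
  | Posz k => iter k T
  | Negz k => iter k.+1 (homeo_inv T)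
  end.

Definition minimal (X : topologicalType) (T : homeo X) : Prop :=
  forall x : X, dense (range (fun n : int => hpow T n x)).

Definition distal (R : realType) (X : metricType R) (T : homeo X) : Prop :=
  forall x y : X, x <> y ->
    0 < inf (range (fun n : int => mdist (hpow T n x) (hpow T n y))).

Definition pow4 (X : Type) : Type := (X * X * X * X)%type.

(* X^8 is represented as X^4 * X^4; for a topological space the topology on
   iterated pairs is the product topology. *)
Definition pow8 (X : Type) : Type := (pow4 X * pow4 X)%type.

Definition dyn_parallelograms (X : topologicalType) (T : homeo X) :
    set (pow4 X) :=
  closure [set q : X * X * X * X | exists (x : X) (m n : int),
    q = (x, hpow T m x, hpow T n x, hpow T (m + n) x)].

Definition dyn_parallelepipeds (X : topologicalType) (T : homeo X) :
    set (pow8 X) :=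
  closure [set q : (X * X * X * X) * (X * X * X * X) |
    exists (x : X) (m n p : int),
    q = ((x, hpow T m x, hpow T n x, hpow T (m + n) x),
         (hpow T p x, hpow T (m + p) x, hpow T (n + p) x,
          hpow T (m + n + p) x))].

Record parallelogram_structure (X : Type) (P : set (pow4 X)) : Prop := {
  pgram_nonempty : inhabited X ;
  pgram_equiv : RelationClasses.Equivalence
    (fun a b : X * X => P (a.1, a.2, b.1, b.2)) ;
  pgram_sym : forall x0 x1 x2 x3 : X, P (x0, x1, x2, x3) -> P (x0, x2, x1, x3) ;
  pgram_closing : forall x0 x1 x2 : X, exists x3 : X, P (x0, x1, x2, x3) }.

Definition coord8 (X : Type) (x : pow8 X) (i : 'I_8) : X :=
  let: ((x0, x1, x2, x3), (x4, x5, x6, x7)) := x in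
  tnth [tuple x0; x1; x2; x3; x4; x5; x6; x7] i.

Definition permute8 (X : Type) (s : 'S_8) (x : pow8 X) : pow8 X :=
  let y (k : nat) : X := coord8 x (s (inord k)) in
  ((y 0%N, y 1%N, y 2%N, y 3%N), (y 4%N, y 5%N, y 6%N, y 7%N)).

Definition unit_cube (R : realType) : set 'rV[R]_3 :=
  [set u | forall j : 'I_3, 0 <= u 0 j <= 1].

(* Row vectors carry the sup norm in the library, whence an explicit Euclidean
   distance. *)
Definition eucl_dist (R : realType) (u v : 'rV[R]_3) : R :=
  Num.sqrt (\sum_(j < 3) (u 0 j - v 0 j) ^+ 2).

Definition cube_isometry (R : realType) (f : 'rV[R]_3 -> 'rV[R]_3) : Prop :=
  set_bij (@unit_cube R) (@unit_cube R) f /\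
  (forall u v : 'rV[R]_3, unit_cube u -> unit_cube v ->
    eucl_dist (f u) (f v) = eucl_dist u v).

(* The vertex whose coordinates are the binary digits of i, the least
   significant one first. *)
Definition vertex (R : realType) (i : 'I_8) : 'rV[R]_3 :=
  \row_(j < 3) ((i %/ 2 ^ j) %% 2)%N%:R.

Definition euclidean_perm (R : realType) (s : 'S_8) : Prop :=
  exists2 f : 'rV[R]_3 -> 'rV[R]_3,
    cube_isometry f & forall i : 'I_8, f (vertex R i) = vertex R (s i).

(* R is only the copy of the real numbers over which the unit cube is taken. *)
Record parallelepiped_structure (R : realType) (X : Type)
    (P : set (pow4 X)) (Q : set (pow8 X)) : Prop := {
  ppiped_pgram : parallelogram_structure P ;
  ppiped_faces : forall x0 x1 x2 x3 x4 x5 x6 x7 : X,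
    Q ((x0, x1, x2, x3), (x4, x5, x6, x7)) ->
    [/\ P (x0, x1, x2, x3) /\ P (x4, x5, x6, x7),
        P (x0, x1, x4, x5) /\ P (x2, x3, x6, x7) &
        P (x0, x2, x4, x6) /\ P (x1, x3, x5, x7)] ;
  ppiped_sym : forall s : 'S_8, euclidean_perm R s ->
    forall x : pow8 X, Q x -> Q (permute8 s x) ;
  ppiped_equiv : RelationClasses.Equivalence
    (fun x y : {x : pow4 X | P x} => Q (sval x, sval y)) ;
  ppiped_closing : forall x0 x1 x2 x3 x4 x5 x6 : X,
    P (x0, x1, x2, x3) -> P (x0, x1, x4, x5) -> P (x0, x2, x4, x6) ->
    exists x7 : X, Q ((x0, x1, x2, x3), (x4, x5, x6, x7)) }.

(* Main.v *)
(* Distality makes the enveloping semigroup of every product power a group: by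
   Ellis-Numakura each closed subsemigroup contains an idempotent, and an
   idempotent can only be the identity.  Hence orbit closures are minimal.  So P
   and Q are the orbit closures of any constant point under the actions of the
   exponent vectors that are affine on the square, resp. on the cube, and to put
   a point in such a set it suffices to move it to the diagonal.  Transitivity
   and the closing property of Q follow by moving one face after the other to
   the diagonal. *)

Require Import Defs.
From mathcomp Require Import all_boot all_order all_fingroup all_algebra.
From mathcomp Require Import all_classical all_reals all_analysis.
From mathcomp Require Import zify.

Set Implicit Arguments.
Unset Strict Implicit.
Unset Printing Implicit Defensive.

Import Order.TTheory GRing.Theory Num.Theory.

Local Open Scope classical_set_scope.

(** * Closures, continuity and compactness in the topology of pointwise convergence *)

Lemma closed_equalizer (S T : topologicalType) (f g : S -> T) :
  hausdorff_space T -> continuous f -> continuous g ->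
  closed [set x | f x = g x].
Proof.
move=> hT cf cg x clx; apply: hT => A B fA gB.
have nA : nbhs x (f @^-1` A) by exact: cf.
have nB : nbhs x (g @^-1` B) by exact: cg.
have [y [/= fgy [Ay By]]] := clx _ (filterI nA nB).
by exists (f y); split=> //; rewrite fgy.
Qed.

Lemma continuous_pairing (S T U : topologicalType) (f : S -> T) (g : S -> U) :
  continuous f -> continuous g -> continuous (fun s => (f s, g s)).
Proof. by move=> cf cg s; exact: cvg_pair (cf s) (cg s). Qed.

(** The preimage of a closed set is closed. Most facts about orbit closures below are obtained this
    way, by checking them on the orbit only. *)
Lemma closure_preimage (S T : topologicalType) (f : S -> T) A B :
  continuous f -> A `<=` f @^-1` closure B ->
  closure A `<=` f @^-1` closure B.
Proof.
move=> /continuous_closedP cf AB.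
have /closure_id -> : closed (f @^-1` closure B).
  by apply: cf; exact: closed_closure.
exact: closureS.
Qed.

Lemma ptws_continuous (I : Type) (S T : topologicalType)
  (f : S -> {ptws I -> T}) :
  (forall i, continuous (fun s => f s i)) -> continuous f.
Proof.
move=> cf s; apply/cvg_sup => i.
exact: (@continuous_comp_initial _ _ _ (fun g : I -> T => g i) f (cf i)).
Qed.

Lemma ptws_eval_continuous (I : Type) (T : topologicalType) (i : I) :
  continuous (fun f : {ptws I -> T} => f i).
Proof. exact: (@proj_continuous {classic I} (fun=> T) i). Qed.

Lemma ptws_reindex_continuous (I J : Type) (T : topologicalType) (f : J -> I) :
  continuous (fun y : {ptws I -> T} => y \o f : {ptws J -> T}).
Proof. by apply: ptws_continuous => j; exact: ptws_eval_continuous. Qed.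

Lemma ptws_compact (I : Type) (T : topologicalType) :
  compact [set: T] -> compact [set: {ptws I -> T}].
Proof.
move=> cT; have := @tychonoff {classic I} (fun=> T) (fun=> setT) (fun=> cT).
by congr compact; apply/seteqP; split.
Qed.

Lemma ptws_hausdorff (I : Type) (T : topologicalType) :
  hausdorff_space T -> hausdorff_space {ptws I -> T}.
Proof. by move=> hT; exact: (@hausdorff_product {classic I} (fun=> T)). Qed.

(** The image of the compact set [closure A] is compact, hence closed, and it contains the image of
    [A]. *)
Lemma closure_image_compact (S T : topologicalType) (f : S -> T) A :
  compact [set: S] -> hausdorff_space T -> continuous f ->
  closure (f @` A) `<=` f @` closure A.
Proof.
move=> cS hT cf.
have : closed (f @` closure A).
  apply: compact_closed => //; apply: continuous_compact.
    exact: continuous_subspaceT.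
  by apply: subclosed_compact cS _ => //; exact: closed_closure.
move/closure_id => ->; apply: closureS.
by apply: image_subset; exact: subset_closure.
Qed.

(** * Idempotents in compact right topological semigroups *)

Section EllisNumakura.
Variables (T : topologicalType) (op : T -> T -> T).
Hypothesis T_hausdorff : hausdorff_space T.
Hypothesis opA : associative op.
Hypothesis op_continuous : forall q, continuous (op^~ q).

Definition closed_subsemigroup (S : set T) :=
  [/\ S !=set0, closed S & forall p q, S p -> S q -> S (op p q)].

Lemma exists_minimal_closed_subsemigroup (S : set T) :
  compact S -> closed_subsemigroup S ->
  exists2 M, closed_subsemigroup M /\ M `<=` S &
    forall L, closed_subsemigroup L -> L `<=` M -> M `<=` L.
Proof.
move=> cS sS.
(* Zorn's lemma is applied to the part [U] removed from [S]: a union of removed parts is an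
   intersection of subsemigroups, and a maximal [U] leaves a minimal one. *)
have [F FP Ftot|A [PA maxA]] :=
    @Zorn_bigcup _ [set U | closed_subsemigroup (S `\` U)].
  have [->|/set0P [U0 FU0]] := eqVneq F set0.
    by rewrite /= bigcup_set0 setD0.
  have bigE : S `\` \bigcup_(U in F) U = \bigcap_(U in F) (S `\` U).
    apply/seteqP; split => [p [Sp nUp] U FU|p Fp].
      by split=> // Up; apply: nUp; exists U.
    by split=> [|[U FU Up]]; [case: (Fp _ FU0)|case: (Fp _ FU)].
  rewrite /= bigE; split.
  (* The sets left over form a chain of nonempty sets, so they generate a proper filter; a cluster
     point of it lies in each of them because they are closed. *)
  - pose G := filter_from F (fun U => S `\` U).
    have GF : ProperFilter G.
      apply: filter_from_proper; last by move=> U /FP [].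
      apply: filter_from_filter; first by exists U0.
      move=> U V FU FV; have [UV|VU] := Ftot _ _ FU FV.
        by exists V => // p [Sp Vp]; split; split=> // /UV.
      by exists U => // p [Sp Up]; split; split=> // /VU.
    have [|p [_ clp]] := cS _ GF; first by exists U0 => // p [].
    exists p => U FU; have [_ + _] := FP _ FU; apply => B Bp.
    by apply: clp => //; exists U.
  - by apply: closed_bigI => U /FP [].
  - move=> p q Sp Sq U FU; have [_ _] := FP _ FU.
    by apply; [exact: Sp|exact: Sq].
exists (S `\` A); first by split=> // p [].
move=> L sL LA.
have PL : closed_subsemigroup (S `\` ~` L).
  rewrite setDE setCK; suff -> : S `&` L = L by [].
  by apply/setIidPr => p /LA [].
have AL : A `<=` ~` L by move=> p Ap /LA [].
apply: contrapT => nML; apply: (maxA (~` L)) => //; split=> // LA'.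
apply: nML => p [Sp nAp]; apply: contrapT => nLp; exact: nAp (LA' _ nLp).
Qed.

(* In a minimal closed subsemigroup M, both [M p] and [{q in M | q p = p}] are
   closed subsemigroups, hence all of M. *)
Lemma exists_idempotent (S : set T) :
  compact S -> closed_subsemigroup S -> exists2 u, S u & op u u = u.
Proof.
move=> cS sS.
have [M [[[p Mp] clM opM] MS] minM] := exists_minimal_closed_subsemigroup cS sS.
exists p; first exact: MS.
have cM : compact M by exact: subclosed_compact cS MS.
have [|_ [q Mq <-]|q Mq qp] := minM ((op^~ p) @` M) _ _ p Mp.
- split; first by exists (op p p), p.
    apply: compact_closed => //; apply: continuous_compact => //.
    exact: continuous_subspaceT.
  move=> _ _ [q Mq <-] [r Mr <-]; exists (op (op q p) r); last by rewrite !opA.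
  exact: (opM _ _ (opM _ _ Mq Mp) Mr).
- exact: opM.
have [||] := minM (M `&` [set q | op q p = p]) _ _ p Mp; last by [].
- split; first by exists q.
    apply: closedI => //; apply: closed_equalizer => //.
    exact: cst_continuous.
  by move=> r s [Mr rp] [Ms sp]; split; [exact: opM|rewrite /= -opA sp rp].
- by move=> ? [].
Qed.

End EllisNumakura.

(** * Orbit closures and the enveloping semigroup of a distal action *)

Definition orbit_closure (Y : topologicalType) (G : set (Y -> Y)) (y : Y) :=
  closure [set g y | g in G].

Section DistalSemigroup.
Variables (Y : topologicalType) (G : set (Y -> Y)).
Hypothesis Y_compact : compact [set: Y].
Hypothesis Y_hausdorff : hausdorff_space Y.
Hypothesis G_comp : forall f g, G f -> G g -> G (f \o g).
Hypothesis G_continuous : forall g, G g -> continuous g.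

Lemma orbit_closure_trans x y :
  orbit_closure G x y -> orbit_closure G y `<=` orbit_closure G x.
Proof.
move=> xy; have -> : orbit_closure G x = closure (orbit_closure G x).
  by apply/closure_id; exact: closed_closure.
apply: closureS => _ [g Gg <-].
apply: (@closure_preimage _ _ g _ _ (G_continuous Gg) _ _ xy) => _ [f Gf <-].
by apply: subset_closure; exists (g \o f) => //; exact: G_comp.
Qed.

Let E : set {ptws Y -> Y} := closure (G : set {ptws Y -> Y}).

(** Composition is continuous in its left factor always, but in its right factor only when the left
    one is continuous. So [p] is first approximated by elements of [G], and only then [q]. *)
Let E_comp p q : E p -> E q -> E (p \o q).
Proof.
move=> Ep Eq.
pose right (r : {ptws Y -> Y}) : {ptws Y -> Y} := r \o q.
apply: (@closure_preimage _ _ right G G _ _ _ Ep) => [|g Gg].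
  exact: ptws_reindex_continuous.
pose left (r : {ptws Y -> Y}) : {ptws Y -> Y} := g \o r.
apply: (@closure_preimage _ _ left G G _ _ _ Eq) => [|f Gf].
  apply: ptws_continuous => y f.
  apply: (@continuous_comp _ _ _ (fun r : {ptws Y -> Y} => r y) g).
    exact: ptws_eval_continuous.
  exact: G_continuous.
by apply: subset_closure; exact: G_comp.
Qed.

(* The idempotents of the enveloping semigroup are proximal to the identity,
   so that in the distal case each [E p] contains the identity. *)
Theorem distal_orbit_closure_sym :
  (forall y y' z, closure [set (g y, g y') | g in G] (z, z) -> y = y') ->
  forall y z, orbit_closure G y z -> orbit_closure G z y.
Proof.
move=> G_distal y z yz.
have E_compact : compact E.
  by apply: subclosed_compact (@ptws_compact Y _ Y_compact) _ => //;
    exact: closed_closure.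
have [p Ep pz] : ((fun p : {ptws Y -> Y} => p y) @` E) z.
  apply: closure_image_compact.
  - exact: ptws_compact.
  - exact: Y_hausdorff.
  - exact: ptws_eval_continuous.
  - by move: yz; apply: closureS => _ [g Gg <-]; exists g.
pose right (q r : {ptws Y -> Y}) : {ptws Y -> Y} := q \o r.
have right_continuous q : continuous (right^~ q).
  exact: ptws_reindex_continuous.
have H := ptws_hausdorff (I := Y) Y_hausdorff.
have cEp : compact ((right^~ p) @` E).
  by apply: continuous_compact => //; exact: continuous_subspaceT.
(* The idempotent is sought in the left ideal [E p], so that it has the form [q \o p]; then [q] is
   the candidate for an inverse of [p]. *)
have [|_ [q Eq <-] idem] := @exists_idempotent _ right H (fun _ _ _ => erefl)
    right_continuous _ cEp.
  split; first by exists (right p p), p.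
    exact: compact_closed.
  move=> _ _ [q Eq <-] [r Er <-]; exists (right (right q p) r) => //.
  by apply: E_comp => //; exact: E_comp.
have qpE : E (right q p) by exact: E_comp.
(* The idempotent [q \o p] sends both [y] and [q (p y)] to [q (p y)]; these two points are therefore
   proximal, hence equal. *)
have -> : y = q z.
  apply: (G_distal _ _ (q z)); rewrite -pz.
  have cpair : continuous (fun r : {ptws Y -> Y} => (r y, r (q (p y)))).
    by apply: continuous_pairing; exact: ptws_eval_continuous.
  have qqp : q (p (q (p y))) = q (p y) by exact: (congr1 (@^~ y) idem).
  have sub : E `<=` (fun r : {ptws Y -> Y} => (r y, r (q (p y)))) @^-1`
      closure [set (g y, g (q (p y))) | g in G].
    apply: closure_preimage => // g Gg.
    by apply: subset_closure; exists g.
  have : closure [set (g y, g (q (p y))) | g in G]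
      (q (p y), q (p (q (p y)))) := sub _ qpE.
  by rewrite qqp.
apply: (@closure_preimage _ _ (fun r : {ptws Y -> Y} => r z) G _ _ _ _ Eq).
  exact: ptws_eval_continuous.
by move=> g Gg; apply: subset_closure; exists g.
Qed.

End DistalSemigroup.

Local Open Scope ring_scope.

(** * Integer powers of a homeomorphism *)

Section HomeoPowers.
Variables (X : topologicalType) (T : homeo X).

Lemma hpow_continuous n : continuous (hpow T n).
Proof.
have iter_continuous (f : X -> X) k : continuous f -> continuous (iter k f).
  move=> cf; elim: k => [|k IH] x /=; first exact: cvg_id.
  exact: (@continuous_comp _ _ _ (iter k f) f x (IH x) (cf _)).
case: n => k; apply: iter_continuous.
  exact: homeo_continuous.
exact: homeo_inv_continuous.
Qed.

Lemma hpowD1 n x : hpow T (1 + n) x = T (hpow T n x).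
Proof.
case: n => [n|[|n]]; first by rewrite -PoszD.
  by rewrite /= homeoVK.
have -> : 1 + Negz n.+1 = Negz n by rewrite !NegzE; lia.
by rewrite /= homeoVK.
Qed.

Lemma hpowBD1 n x : hpow T (-1 + n) x = homeo_inv T (hpow T n x).
Proof.
rewrite -[in RHS](addKr (-1) n) opprK [X in hpow T X]addrC addrC.
by rewrite hpowD1 homeoK.
Qed.

Lemma hpowD m n x : hpow T (m + n) x = hpow T m (hpow T n x).
Proof.
elim/int_rec: m => [|k IH|k IH]; first by rewrite add0r.
  by rewrite intS -addrA !hpowD1 IH.
by rewrite intS opprD -addrA !hpowBD1 IH.
Qed.

End HomeoPowers.

(** * Exponent vectors that are affine on the square and on the cube *)

Definition exponent_monoid (I : Type) (L : set (I -> int)) :=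
  L (fun=> 0) /\ forall d e, L d -> L e -> L (fun i => d i + e i).

(** Adds one direction to [L]: taking [B] to be [bool] passes from the edge to the square and from
    the square to the cube. A larger [B] stacks several copies of a face, as in the proof of
    transitivity. *)
Definition prod_exponents (B K : Type) (L : set (K -> int)) :
    set (B * K -> int) :=
  [set e | exists nu la, L la /\ e = fun bk => nu bk.1 + la bk.2].

Lemma prod_exponent_monoid (B K : Type) (L : set (K -> int)) :
  exponent_monoid L -> exponent_monoid (prod_exponents (B := B) L).
Proof.
move=> [L0 LD]; split.
  by exists (fun=> 0), (fun=> 0); split=> //.
move=> _ _ [nu [la [Lla ->]]] [nu' [la' [Lla' ->]]].
exists (fun b => nu b + nu' b), (fun k => la k + la' k); split; first exact: LD.
by apply/funext => -[b k]; rewrite addrACA.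
Qed.

Lemma prod_exponents_cst (B K : Type) (L : set (K -> int)) n :
  exponent_monoid L -> prod_exponents (B := B) L (fun=> n).
Proof.
move=> [L0 _]; exists (fun=> n), (fun=> 0); split=> //.
by apply/funext => -[b k]; rewrite addr0.
Qed.

Lemma prod_exponents_reindex (B B' K : Type) (h : B' -> B) (L : set (K -> int))
    e :
  prod_exponents L e ->
  prod_exponents L (e \o (fun bk : B' * K => (h bk.1, bk.2))).
Proof. by move=> [nu [la [Lla ->]]]; exists (nu \o h), la. Qed.

Definition square_exponents : set (bool * bool -> int) :=
  prod_exponents [set: bool -> int].

(* The vertex of index [e1 + 2 e2 + 4 e3] is [(e3, (e2, e1))]. *)
Definition cube_exponents : set (bool * (bool * bool) -> int) :=
  prod_exponents square_exponents.

Lemma square_exponent_monoid : exponent_monoid square_exponents.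
Proof. exact: prod_exponent_monoid. Qed.

Lemma cube_exponent_monoid : exponent_monoid cube_exponents.
Proof. exact: prod_exponent_monoid square_exponent_monoid. Qed.

Lemma square_exponentsP e :
  square_exponents e <->
  e (false, false) + e (true, true) = e (false, true) + e (true, false).
Proof.
split=> [[nu [la [_ ->]]] /=|eE]; first by lia.
exists (fun c => e (c, false) - e (false, false)), (fun b => e (false, b)).
by split=> //; apply/funext => -[[] []] /=; lia.
Qed.

(** Affine functions on the cube form a group of rank 4 among the 8 coordinates. The four equations
    are the affine conditions on the three faces at 000 and on the face opposite to the first of
    them. *)
Lemma cube_exponentsP e :
  cube_exponents e <->
  [/\ e (false, (false, false)) + e (false, (true, true)) =
        e (false, (false, true)) + e (false, (true, false)),
      e (false, (false, false)) + e (true, (false, true)) =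
        e (false, (false, true)) + e (true, (false, false)),
      e (false, (false, false)) + e (true, (true, false)) =
        e (false, (true, false)) + e (true, (false, false)) &
      e (true, (false, false)) + e (true, (true, true)) =
        e (true, (false, true)) + e (true, (true, false))].
Proof.
split=> [[nu [la [/square_exponentsP laE ->]]] /=|[e1 e2 e3 e4]].
  by split; lia.
exists (fun d => e (d, (false, false)) - e (false, (false, false))).
exists (fun cb => e (false, cb)); split; first exact/square_exponentsP.
by apply/funext => -[[] [[] []]] /=; lia.
Qed.

(** * Euclidean permutations as isometries for the Hamming distance *)

Definition vertex_bits (i : 'I_8) : bool * (bool * bool) :=
  (odd (i %/ 4), (odd (i %/ 2), odd i)).

Definition vertex_index (v : bool * (bool * bool)) : 'I_8 :=
  inord (v.2.2 + 2 * v.2.1 + 4 * v.1).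

Definition hamming (u v : bool * (bool * bool)) : nat :=
  (u.1 (+) v.1) + (u.2.1 (+) v.2.1) + (u.2.2 (+) v.2.2).

Lemma vertex_indexK : cancel vertex_index vertex_bits.
Proof.
by move=> [[] [[] []]]; rewrite /vertex_bits /vertex_index inordK.
Qed.

Lemma eucl_dist_vertex (R : realType) i j :
  eucl_dist (vertex R i) (vertex R j) =
  Num.sqrt (hamming (vertex_bits i) (vertex_bits j))%:R.
Proof.
have sqrB (b c : bool) : (b%:R - c%:R) ^+ 2 = (b (+) c)%:R :> R.
  by case: b c => [] []; rewrite ?subrr ?subr0 ?sub0r ?sqrrN ?expr0n ?expr1n.
rewrite /eucl_dist !big_ord_recl big_ord0 !mxE /= !modn2 !sqrB.
by rewrite !divn1 addr0 /hamming !natrD addrC [X in _ = Num.sqrt (X + _)]addrC.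
Qed.

(** Between vertices, the Hamming distance is the square of the Euclidean one. *)
Lemma euclidean_perm_hamming (R : realType) (s : 'S_8) i j :
  euclidean_perm R s ->
  hamming (vertex_bits (s i)) (vertex_bits (s j)) =
  hamming (vertex_bits i) (vertex_bits j).
Proof.
move=> [f [_ f_isom] fs].
have in_cube k : unit_cube (vertex R k).
  by move=> l; rewrite mxE modn2; case: odd; rewrite ?lexx ler01.
have := f_isom _ _ (in_cube i) (in_cube j).
rewrite !fs !eucl_dist_vertex => /(congr1 (fun x => x ^+ 2)).
by rewrite !sqr_sqrtr ?ler0n// => /eqP; rewrite eqr_nat => /eqP.
Qed.

(** The six distances say that the four vertices form a face with diagonals [u1 u4] and [u2 u3].
    Being purely metric, this description is carried along by isometries, and no list of the
    symmetries of the cube is called for. *)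
Lemma cube_exponents_hamming_square e (u1 u2 u3 u4 : bool * (bool * bool)) :
  cube_exponents e ->
  hamming u1 u2 = 1%N -> hamming u1 u3 = 1%N -> hamming u2 u4 = 1%N ->
  hamming u3 u4 = 1%N -> hamming u1 u4 = 2%N -> hamming u2 u3 = 2%N ->
  e u1 + e u4 = e u2 + e u3.
Proof.
move=> [nu [_ [[ka [la [_ ->]]] ->]]].
by move: u1 u2 u3 u4 => [[] [[] []]] [[] [[] []]] //
  [[] [[] []]] // [[] [[] []]] // *; rewrite /=; lia.
Qed.

Lemma cube_exponents_isometry e
    (f : bool * (bool * bool) -> bool * (bool * bool)) :
  (forall u v, hamming (f u) (f v) = hamming u v) ->
  cube_exponents e -> cube_exponents (e \o f).
Proof.
move=> f_isom Ce; apply/cube_exponentsP.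
by split=> /=; apply: (cube_exponents_hamming_square (e := e)) => //;
  rewrite f_isom.
Qed.

(** * Orbit closures in powers of the system *)

Section PowerActions.
Variables (R : realType) (X : metricType R) (T : homeo X).
Hypothesis X_compact : compact [set: X].
Hypothesis T_minimal : minimal T.
Hypothesis T_distal : distal T.

Let X_hausdorff : hausdorff_space X := @metric_hausdorff R X.

Definition power_action (I : Type) (e : I -> int) (y : {ptws I -> X}) :
    {ptws I -> X} :=
  fun i => hpow T (e i) (y i).

Definition orb (I : Type) (L : set (I -> int)) (y : {ptws I -> X}) :=
  orbit_closure [set power_action e | e in L] y.

Lemma power_action_continuous (I : Type) (e : I -> int) :
  continuous (power_action e).
Proof.
apply: ptws_continuous => i y.
apply: (@continuous_comp _ _ _ (fun z : {ptws I -> X} => z i)).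
  exact: ptws_eval_continuous.
exact: hpow_continuous.
Qed.

Lemma power_action_comp (I : Type) (d e : I -> int) y :
  power_action (fun i => d i + e i) y = power_action d (power_action e y).
Proof. by apply/funext => i; rewrite /power_action hpowD. Qed.

Lemma orbE (I : Type) (L : set (I -> int)) y :
  orb L y = closure [set power_action e y | e in L].
Proof. by rewrite /orb /orbit_closure image_comp. Qed.

Lemma orb_act (I : Type) (L : set (I -> int)) e y :
  L e -> orb L y (power_action e y).
Proof. by rewrite orbE => Le; apply: subset_closure; exists e. Qed.

Lemma orb_subset (I : Type) (L L' : set (I -> int)) y :
  L `<=` L' -> orb L y `<=` orb L' y.
Proof.
by rewrite !orbE => LL'; apply: closureS; exact: image_subset.
Qed.

Lemma orb_trans (I : Type) (L : set (I -> int)) x y :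
  exponent_monoid L -> orb L x y -> orb L y `<=` orb L x.
Proof.
move=> [_ LD]; apply: orbit_closure_trans.
  move=> _ _ [d Ld <-] [e Le <-]; exists (fun i => d i + e i); first exact: LD.
  by apply/funext => z; exact: power_action_comp.
by move=> _ [e _ <-]; exact: power_action_continuous.
Qed.

(** If [y] and [y'] differ at [i], a common power brings both coordinates within half the infimum
    [d] of their distances from [z i], hence closer than [d] to each other. *)
Lemma power_action_distal (I : Type) (L : set (I -> int)) y y' z :
  closure [set (power_action e y, power_action e y') | e in L] (z, z) ->
  y = y'.
Proof.
move=> clz; apply/funext => i; apply: contrapT => yy'i.
have := T_distal yy'i; set d := inf _ => d0.
have lb n : d <= mdist (hpow T n (y i)) (hpow T n (y' i)).
  apply: ge_inf; last by exists n.
  by exists 0 => _ [k _ <-]; exact: mdist_ge0.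
have d20 : 0 < d / 2 by rewrite divr_gt0.
have nb : nbhs (z : {ptws I -> X})
    ((fun u : {ptws I -> X} => u i) @^-1` ball (z i) (d / 2)).
  apply: (@ptws_eval_continuous _ _ i z).
  exact: nbhsx_ballx.
pose B := (fun u : {ptws I -> X} => u i) @^-1` ball (z i) (d / 2).
have [|_ [[e Le <-] [/= b1 b2]]] := clz (B `*` B).
  by exists (B, B).
have := lb (e i); rewrite leNgt => /negP; apply.
have : ball (power_action e y i) d (power_action e y' i).
  exact: (@ball_splitr _ _ (z i)).
by rewrite ballEmdist.
Qed.

Lemma orb_sym (I : Type) (L : set (I -> int)) y z :
  exponent_monoid L -> orb L y z -> orb L z y.
Proof.
move=> [L0 LD]; apply: distal_orbit_closure_sym.
- exact: ptws_compact.
- exact: ptws_hausdorff.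
- move=> _ _ [d Ld <-] [e Le <-]; exists (fun i => d i + e i); first exact: LD.
  by apply/funext => u; exact: power_action_comp.
- by move=> _ [e _ <-]; exact: power_action_continuous.
- move=> u u' v; rewrite image_comp; exact: power_action_distal.
Qed.

Lemma orb_reindex (I J : Type) (f : J -> I) (L : set (I -> int))
    (L' : set (J -> int)) y z :
  (forall e, L e -> L' (e \o f)) -> orb L y z -> orb L' (y \o f) (z \o f).
Proof.
rewrite !orbE => LL' yz.
pose F (u : {ptws I -> X}) : {ptws J -> X} := u \o f.
apply: (@closure_preimage _ _ F _ _ _ _ _ yz).
  exact: ptws_reindex_continuous.
move=> _ [e Le <-]; apply: subset_closure.
by exists (e \o f) => //; exact: LL'.
Qed.

(** By compactness, a motion of the coordinates selected by [f] extends to all coordinates, the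
    others converging to some uncontrolled limit. This is the tool for moving one face while
    dragging the rest along. *)
Lemma orb_lift (I J : Type) (f : J -> I) (L : set (I -> int))
    (L' : set (J -> int)) y z :
  (forall e', L' e' -> exists2 e, L e & e \o f = e') ->
  orb L' (y \o f) z -> exists2 y', orb L y y' & y' \o f = z.
Proof.
rewrite !orbE => LL' yz.
pose F (u : {ptws I -> X}) : {ptws J -> X} := u \o f.
apply: (@closure_image_compact _ _ F).
- exact: ptws_compact.
- exact: ptws_hausdorff.
- exact: ptws_reindex_continuous.
apply: closureS yz => _ [_ /LL' [e Le <-] <-].
by exists (power_action e y) => //; exists e.
Qed.

(** Equality of two coordinates is a closed condition; it preserves what earlier moves have
    achieved. *)
Lemma orb_eq_coord (I : Type) (i j : I) (L : set (I -> int)) y z :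
  (forall e, L e -> e i = e j) -> y i = y j -> orb L y z -> z i = z j.
Proof.
rewrite orbE => Lij yij yz.
have := @closed_equalizer _ _ (fun u : {ptws I -> X} => u i)
  (fun u : {ptws I -> X} => u j) X_hausdorff
  (@ptws_eval_continuous _ _ i) (@ptws_eval_continuous _ _ j).
move=> /closure_id; set S := mkset _ => clS.
suff : S z by [].
rewrite clS; apply: closureS yz => _ [e Le <-].
by rewrite /S /= /power_action (Lij _ Le) yij.
Qed.

Lemma orb_fixed_coord (I : Type) (i : I) (L : set (I -> int)) y z :
  (forall e, L e -> e i = 0) -> orb L y z -> z i = y i.
Proof.
rewrite orbE => Li yz.
have := @closed_equalizer _ _ (fun u : {ptws I -> X} => u i) (fun=> y i)
  X_hausdorff (@ptws_eval_continuous _ _ i) (@cst_continuous _ _ _).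
move=> /closure_id; set S := mkset _ => clS.
suff : S z by [].
rewrite clS; apply: closureS yz => _ [e Le <-].
by rewrite /S /= /power_action (Li _ Le).
Qed.

(** The diagonal embedding carries the dense orbit of [x] into the orbit of the constant point. *)
Lemma orb_cst (I : Type) (L : set (I -> int)) (x x' : X) :
  (forall n, L (fun=> n)) -> orb L (fun=> x) (fun=> x').
Proof.
move=> Lcst; rewrite orbE.
have clx : closure (range (fun n => hpow T n x)) x'.
  move=> B; rewrite nbhsE => -[U [oU Ux'] UB].
  have [y [Uy Oy]] := T_minimal x (ex_intro _ x' Ux') oU.
  by exists y; split=> //; exact: UB.
pose F (u : X) : {ptws I -> X} := fun=> u.
apply: (@closure_preimage _ _ F _ _ _ _ _ clx).
  by apply: ptws_continuous => i u; exact: cvg_id.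
by move=> _ [n _ <-]; apply: subset_closure; exists (fun=> n).
Qed.

(** * Hulls of the diagonal, and transitivity *)

Variable x0 : X.

Definition hull (I : Type) (L : set (I -> int)) : set {ptws I -> X} :=
  orb L (fun=> x0).

Lemma orb_hull (I : Type) (L : set (I -> int)) y :
  exponent_monoid L -> orb L y (fun=> x0) -> hull L y.
Proof. exact: orb_sym. Qed.

Lemma hull_orb (I : Type) (L : set (I -> int)) y :
  exponent_monoid L -> hull L y -> orb L y (fun=> x0).
Proof. exact: orb_sym. Qed.

Lemma hull_orbS (I : Type) (L : set (I -> int)) y :
  exponent_monoid L -> hull L y -> orb L y `<=` hull L.
Proof. exact: orb_trans. Qed.

Lemma hull_reindex (I J : Type) (f : J -> I) (L : set (I -> int))
    (L' : set (J -> int)) y :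
  (forall e, L e -> L' (e \o f)) -> hull L y -> hull L' (y \o f).
Proof. exact: orb_reindex. Qed.

Lemma hull_power_cst (I : Type) (L : set (I -> int)) e x :
  exponent_monoid L -> (forall n, L (fun=> n)) -> L e ->
  hull L (fun i => hpow T (e i) x).
Proof.
move=> mL Lcst Le; apply: (hull_orbS (y := fun=> x) mL).
  exact: orb_cst.
exact: (@orb_act _ _ _ (fun=> x)).
Qed.

Definition glue (K : Type) (u v : K -> X) : {ptws bool * K -> X} :=
  fun bk => if bk.1 then v bk.2 else u bk.2.

Lemma hull_glue_trans (K : Type) (L : set (K -> int)) (u v w : K -> X) :
  exponent_monoid L ->
  hull (prod_exponents L) (glue u v) -> hull (prod_exponents L) (glue v w) ->
  hull (prod_exponents L) (glue u w).
Proof.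
move=> mL uv vw.
have mB B : exponent_monoid (prod_exponents (B := B) L).
  exact: prod_exponent_monoid.
(* The three faces [u], [v], [w] are stacked over [None], [Some false], [Some true]. First [u] and
   [v] are moved to the diagonal, dragging [w]; then [v] and [w], with [u] following [v]. *)
pose pull h (bk : bool * K) : option bool * K := (h bk.1, bk.2).
pose huv b := if b then Some false else None.
pose hvw (b : bool) := Some b.
pose huw b := if b then Some true else None.
pose y : {ptws option bool * K -> X} := fun bk =>
  match bk.1 with None => u | Some false => v | Some true => w end bk.2.
have yuv : y \o pull huv = glue u v by apply/funext => -[[] k].
have yvw : y \o pull hvw = glue v w by apply/funext => -[[] k].
have yuw : y \o pull huw = glue u w by apply/funext => -[[] k].
have [||y1 y1y y1uv] := @orb_lift _ _ (pull huv) (prod_exponents L)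
    (prod_exponents L) y (fun=> x0).
- move=> _ [nu [la [Lla ->]]].
  exists (fun bk => (if bk.1 is None then nu false else nu true) + la bk.2).
    by exists (fun b => if b is None then nu false else nu true), la.
  by apply/funext => -[[] k].
- by rewrite yuv; exact: hull_orb.
have y1vw : hull (prod_exponents L) (y1 \o pull hvw).
  rewrite -yvw in vw; apply: (hull_orbS _ vw) => //.
  apply: orb_reindex y1y => e; exact: prod_exponents_reindex.
(* Exponents in [L'] treat the copy of [u] as that of [v], so these two copies, both constant after
   the first move, remain equal. *)
pose L' := prod_exponents L `&`
  [set e : option bool * K -> int | forall k, e (None, k) = e (Some false, k)].
have [|y2 y2y1 y2vw] := @orb_lift _ _ (pull hvw) L' (prod_exponents L) y1
    (fun=> x0) _ (hull_orb (mB _) y1vw).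
  move=> _ [nu [la [Lla ->]]].
  exists (fun bk => nu (if bk.1 is Some b then b else false) + la bk.2).
    split=> //.
    by exists (fun b => nu (if b is Some b' then b' else false)), la.
  by apply/funext => -[[] k].
have y2E : y2 = fun=> x0.
  have y2S b k : y2 (Some b, k) = x0 by exact: (congr1 (@^~ (b, k)) y2vw).
  apply/funext => -[[b|] k]; first exact: y2S.
  rewrite -(y2S false k); apply: orb_eq_coord y2y1 => [e []//|].
  transitivity x0; first exact: (congr1 (@^~ (false, k)) y1uv).
  by symmetry; exact: (congr1 (@^~ (true, k)) y1uv).
rewrite -yuw; apply: hull_reindex; first exact: prod_exponents_reindex.
apply: orb_hull => //; rewrite -y2E; apply: (orb_trans (mB _) y1y).
by apply: orb_subset y2y1 => e [].
Qed.

(** * Closing squares and cubes *)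

Lemma square_closing (x1 x2 x3 : X) :
  exists2 y, hull square_exponents y &
    [/\ y (false, false) = x1, y (false, true) = x2 & y (true, false) = x3].
Proof.
have mS := square_exponent_monoid.
pose y0 : {ptws bool * bool -> X} := fun=> x1.
have hy0 : hull square_exponents y0.
  by apply: orb_cst => n; exact: prod_exponents_cst.
(* Starting from the constant square [x1], minimality moves one vertex to [x2] and then another to
   [x3]; [L1] holds the first vertex still, and [L2] the first two. *)
pose L1 := [set e | square_exponents e /\ e (false, false) = 0].
pose L2 := [set e | L1 e /\ e (false, true) = 0].
have pt (x x' : X) : orb [set: unit -> int] (fun=> x) (fun=> x').
  exact: orb_cst.
have [||y1 y1y0 y1E] := @orb_lift _ _ (fun=> (false, true)) L1
    [set: unit -> int] y0 (fun=> x2).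
- move=> e' _; exists (fun cb => if cb.2 then e' tt else 0).
    by split=> //; apply/square_exponentsP => /=; lia.
  by apply/funext => -[].
- exact: pt.
have [||y2 y2y1 y2E] := @orb_lift _ _ (fun=> (true, false)) L2
    [set: unit -> int] y1 (fun=> x3).
- move=> e' _; exists (fun cb => if cb.1 then e' tt else 0).
    by do 2!split=> //; apply/square_exponentsP => /=; lia.
  by apply/funext => -[].
- exact: pt.
exists y2.
  apply: (hull_orbS mS (y := y1)); last by apply: orb_subset y2y1 => e [[]].
  by apply: (hull_orbS mS hy0); apply: orb_subset y1y0 => e [].
split; last exact: (congr1 (@^~ tt) y2E).
  transitivity (y1 (false, false)).
    by apply: orb_fixed_coord y2y1 => e [[]].
  by apply: orb_fixed_coord y1y0 => e [].
transitivity (y1 (false, true)); last exact: (congr1 (@^~ tt) y1E).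
by apply: orb_fixed_coord y2y1 => e [].
Qed.

(* Index the seven given points by the cube, the unknown vertex 111 repeating
   the vertex 000; the three faces at 000 are then moved to the diagonal one
   after the other, using exponents that do not depend on one of the
   coordinates so as to preserve what has been achieved. *)
Lemma cube_closing (w : {ptws bool * (bool * bool) -> X}) :
  hull square_exponents (fun cb => w (false, cb)) ->
  hull square_exponents (fun db => w (db.1, (false, db.2))) ->
  hull square_exponents (fun dc => w (dc.1, (dc.2, false))) ->
  exists2 y, hull cube_exponents y &
    forall i, i != (true, (true, true)) -> y i = w i.
Proof.
move=> w03 w15 w26.
have mS := square_exponent_monoid; have mC := cube_exponent_monoid.
pose f (i : bool * (bool * bool)) :=
  if i == (true, (true, true)) then (false, (false, false)) else i.
pose L := [set e \o f | e in cube_exponents].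
have mL : exponent_monoid L.
  split; first by exists (fun=> 0) => //; exact: mC.1.
  move=> _ _ [d cd <-] [e ce <-]; exists (fun i => d i + e i) => //.
  exact: mC.2.
pose face1 (cb : bool * bool) := (false, cb).
pose face2 (db : bool * bool) := (db.1, (false, db.2)).
pose face3 (dc : bool * bool) := (dc.1, (dc.2, false)).
have L1 e : L e -> square_exponents (e \o face1).
  by move=> [e' /cube_exponentsP [? ? ? ?] <-]; apply/square_exponentsP.
have L2 e : L e -> square_exponents (e \o face2).
  by move=> [e' /cube_exponentsP [? ? ? ?] <-]; apply/square_exponentsP.
have L3 e : L e -> square_exponents (e \o face3).
  by move=> [e' /cube_exponentsP [? ? ? ?] <-]; apply/square_exponentsP.
have L7 e : L e -> e (true, (true, true)) = e (false, (false, false)).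
  by move=> [e' _ <-].
have [||w1 w1w w1E] := @orb_lift _ _ face1 L square_exponents (w \o f)
    (fun=> x0).
- move=> e /square_exponentsP eE; exists (fun i => e (f i).2).
    exists (fun i => e i.2) => //; apply/cube_exponentsP => /=.
    by split; lia.
  by apply/funext => -[[] []].
- exact: hull_orb.
pose M2 := [set e | L e /\ forall b,
  e (false, (true, b)) = e (false, (false, b))].
(* The first move acts on the second face through affine exponents, so this face stays in the hull
   of the diagonal. *)
have w1face2 : hull square_exponents (w1 \o face2).
  apply: (hull_orbS mS w15); have := orb_reindex L2 w1w.
  congr orb; by apply/funext => -[[] []].
have [|w2 w2w1 w2E] := @orb_lift _ _ face2 M2 square_exponents w1
    (fun=> x0) _ (hull_orb mS w1face2).
  move=> e /square_exponentsP eE.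
  exists (fun i => e ((f i).1, (f i).2.2)).
    split=> //; exists (fun i => e (i.1, i.2.2)) => //.
    by apply/cube_exponentsP => /=; split; lia.
  by apply/funext => -[[] []].
have w2w : orb L (w \o f) w2.
  apply: (orb_trans mL w1w); apply: orb_subset w2w1 => e []//.
(* The pair [c = d = true] is left out: the vertex 111 it contains must follow 000, as [L7] says. *)
pose M3 := [set e | L e /\ forall d c, c && d = false ->
  e (d, (c, true)) = e (d, (c, false))].
have w2face3 : hull square_exponents (w2 \o face3).
  apply: (hull_orbS mS w26); have := orb_reindex L3 w2w.
  congr orb; by apply/funext => -[[] []].
have [|w3 w3w2 w3E] := @orb_lift _ _ face3 M3 square_exponents w2
    (fun=> x0) _ (hull_orb mS w2face3).
  move=> e /square_exponentsP eE.
  exists (fun i => e ((f i).1, (f i).2.1)).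
    split=> [|[] []//]; exists (fun i => e (i.1, i.2.1)) => //.
    by apply/cube_exponentsP => /=; split; lia.
  by apply/funext => -[[] []].
have w3w : orb L (w \o f) w3.
  apply: (orb_trans mL w2w); apply: orb_subset w3w2 => e []//.
have w2_01 b : w2 (false, (false, b)) = x0.
  exact: (congr1 (@^~ (false, b)) w2E).
have w2_23 b : w2 (false, (true, b)) = x0.
  rewrite -(w2_01 b); apply: orb_eq_coord w2w1 => [e []//|].
  transitivity x0; first exact: (congr1 (@^~ (true, b)) w1E).
  by symmetry; exact: (congr1 (@^~ (false, b)) w1E).
have w2_45 b : w2 (true, (false, b)) = x0.
  exact: (congr1 (@^~ (true, b)) w2E).
have w3_even d c : w3 (d, (c, false)) = x0.
  exact: (congr1 (@^~ (d, c)) w3E).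
have w3_odd d c : c && d = false -> w3 (d, (c, true)) = x0.
  move=> cd; rewrite -(w3_even d c); apply: orb_eq_coord w3w2.
    by move=> e [_]; exact.
  by case: d c cd => [] [] //=; rewrite ?w2_23 ?w2_45 ?w2_01.
have w3_7 : w3 (true, (true, true)) = x0.
  by rewrite -(w3_even false false); apply: orb_eq_coord w3w.
have w3E' : w3 = fun=> x0.
  by apply/funext => -[d [c []]]; case: d c => [] [] //; rewrite w3_odd.
have hw : hull L (w \o f) by apply: orb_hull => //; rewrite -w3E'.
(* Lifting along [f] frees the vertex 111 from its copy at 000; its new value is the limit supplied
   by compactness. *)
have [||y hy yE] := @orb_lift _ _ f cube_exponents L (fun=> x0) (w \o f).
- by move=> _ [e ce <-]; exists e.
- exact: hw.
exists y => // i i7; have := congr1 (@^~ i) yE.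
by rewrite /= /f (negbTE i7).
Qed.

(** * Parallelograms and parallelepipeds as hulls of the diagonal *)

Definition square_of (q : pow4 X) : {ptws bool * bool -> X} :=
  fun cb => if cb.1 then (if cb.2 then q.2 else q.1.2)
            else (if cb.2 then q.1.1.2 else q.1.1.1).

Definition tuple_of_square (y : {ptws bool * bool -> X}) : pow4 X :=
  (y (false, false), y (false, true), y (true, false), y (true, true)).

Definition cube_of (q : pow8 X) : {ptws bool * (bool * bool) -> X} :=
  glue (square_of q.1) (square_of q.2).

Definition tuple_of_cube (y : {ptws bool * (bool * bool) -> X}) : pow8 X :=
  (tuple_of_square (fun cb => y (false, cb)),
   tuple_of_square (fun cb => y (true, cb))).

Lemma square_ofK : cancel square_of tuple_of_square.
Proof. by move=> [[[? ?] ?] ?]. Qed.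

Lemma cube_ofK : cancel cube_of tuple_of_cube.
Proof. by move=> [[[[? ?] ?] ?] [[[? ?] ?] ?]]. Qed.

Lemma tuple_of_squareK : cancel tuple_of_square square_of.
Proof. by move=> y; apply/funext => -[[] []]. Qed.

Lemma continuous_fst_comp (S U V : topologicalType) (f : S -> U * V) :
  continuous f -> continuous (fun s => (f s).1).
Proof. by move=> cf s; apply: continuous_comp (cf s) _; exact: cvg_fst. Qed.

Lemma continuous_snd_comp (S U V : topologicalType) (f : S -> U * V) :
  continuous f -> continuous (fun s => (f s).2).
Proof. by move=> cf s; apply: continuous_comp (cf s) _; exact: cvg_snd. Qed.

Lemma square_of_continuous (S : topologicalType) (f : S -> pow4 X) :
  continuous f -> continuous (fun s => square_of (f s)).
Proof.
move=> cf; apply: ptws_continuous => -[[] []];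
  do ![exact: cf | apply: continuous_fst_comp | apply: continuous_snd_comp].
Qed.

Lemma tuple_of_square_continuous (S : topologicalType)
    (f : S -> {ptws bool * bool -> X}) :
  continuous f -> continuous (fun s => tuple_of_square (f s)).
Proof.
move=> cf; do 3?[apply: continuous_pairing] => s;
  exact: (continuous_comp (cf s) (@ptws_eval_continuous _ _ _ _)).
Qed.

Lemma cube_of_continuous : continuous cube_of.
Proof.
apply: ptws_continuous => -[[] cb] q.
  apply: (@continuous_comp _ _ _ (fun q => square_of q.2)
    (fun y : {ptws bool * bool -> X} => y cb)).
    by apply: square_of_continuous => ?; exact: cvg_snd.
  exact: ptws_eval_continuous.
apply: (@continuous_comp _ _ _ (fun q => square_of q.1)
  (fun y : {ptws bool * bool -> X} => y cb)).
  by apply: square_of_continuous => ?; exact: cvg_fst.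
exact: ptws_eval_continuous.
Qed.

(** Only generators are compared. Minimality takes care of the free base point [x] in one direction;
    in the other, an affine exponent vector applied to [x0] gives a parallelogram based at a power
    of [x0], with [m] and [n] the increments along the two edges. *)
Lemma dyn_parallelogramsP q :
  dyn_parallelograms T q <-> hull square_exponents (square_of q).
Proof.
have mS := square_exponent_monoid; split=> Hq.
  apply: (@closure_preimage _ _ square_of _ _ _ _ _ Hq).
    by apply: square_of_continuous => s; exact: cvg_id.
  move=> _ [x [m [n ->]]].
  pose e (cb : bool * bool) :=
    (if cb.2 then m else 0) + (if cb.1 then n else 0).
  have Le : square_exponents e by apply/square_exponentsP; rewrite /e /=; lia.
  have Lcst k : square_exponents (fun=> k) by exact: prod_exponents_cst.
  have := hull_power_cst (x := x) mS Lcst Le.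
  congr hull; apply/funext => -[[] []];
    by rewrite /e /square_of /= ?addr0 ?add0r.
rewrite -(square_ofK q) /dyn_parallelograms.
move: Hq; rewrite /hull orbE => Hq.
apply: (@closure_preimage _ _ tuple_of_square _ _ _ _ _ Hq).
  by apply: (@tuple_of_square_continuous _ idfun) => s; exact: cvg_id.
move=> _ [e /square_exponentsP eE <-]; apply: subset_closure.
exists (hpow T (e (false, false)) x0).
exists (e (false, true) - e (false, false)).
exists (e (true, false) - e (false, false)).
rewrite /tuple_of_square /power_action -!hpowD.
by congr (_, hpow T _ _, hpow T _ _, hpow T _ _); lia.
Qed.

Lemma dyn_parallelepipedsP q :
  dyn_parallelepipeds T q <-> hull cube_exponents (cube_of q).
Proof.
have mC := cube_exponent_monoid; split=> Hq.
  apply: (@closure_preimage _ _ cube_of _ _ cube_of_continuous _ _ Hq).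
  move=> _ [x [m [n [p ->]]]].
  pose e (i : bool * (bool * bool)) := (if i.2.2 then m else 0) +
    (if i.2.1 then n else 0) + (if i.1 then p else 0).
  have Le : cube_exponents e.
    by apply/cube_exponentsP; rewrite /e /=; split; lia.
  have Lcst k : cube_exponents (fun=> k).
    by apply: prod_exponents_cst; exact: square_exponent_monoid.
  have := hull_power_cst (x := x) mC Lcst Le.
  congr hull; apply/funext => -[[] [[] []]];
    by rewrite /e /cube_of /glue /square_of /= ?addr0 ?add0r.
rewrite -(cube_ofK q) /dyn_parallelepipeds.
move: Hq; rewrite /hull orbE => Hq.
apply: (@closure_preimage _ _ tuple_of_cube _ _ _ _ _ Hq).
  apply: continuous_pairing.
    apply: (@tuple_of_square_continuous {ptws bool * (bool * bool) -> X}
      (fun y cb => y (false, cb))).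
    exact: ptws_reindex_continuous.
  apply: (@tuple_of_square_continuous {ptws bool * (bool * bool) -> X}
      (fun y cb => y (true, cb))).
  exact: ptws_reindex_continuous.
move=> _ [e /cube_exponentsP [e1 e2 e3 e4] <-]; apply: subset_closure.
pose e0 := e (false, (false, false)).
exists (hpow T e0 x0), (e (false, (false, true)) - e0).
exists (e (false, (true, false)) - e0), (e (true, (false, false)) - e0).
rewrite /tuple_of_cube /tuple_of_square /power_action -!hpowD /e0.
congr ((_, hpow T _ _, hpow T _ _, hpow T _ _),
  (hpow T _ _, hpow T _ _, hpow T _ _, hpow T _ _)); lia.
Qed.

(** * The axioms of a parallelepiped structure *)

Lemma hull_glue_refl (K : Type) (L : set (K -> int)) u :
  hull L u -> hull (prod_exponents L) (glue u u).
Proof.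
have -> : glue u u = u \o snd by apply/funext => -[[] k].
by apply: hull_reindex => e Le; exists (fun=> 0), e; split=> //;
  apply/funext => -[b k]; rewrite add0r.
Qed.

Lemma hull_glue_sym (K : Type) (L : set (K -> int)) u v :
  hull (prod_exponents L) (glue u v) -> hull (prod_exponents L) (glue v u).
Proof.
have -> : glue v u = glue u v \o (fun bk => (~~ bk.1, bk.2)).
  by apply/funext => -[[] k].
by apply: hull_reindex => e; exact: prod_exponents_reindex.
Qed.

(** Any pair is an edge of some parallelogram; this yields reflexivity of the relation on
    [X * X]. *)
Lemma hull_edge (u : bool -> X) : hull setT u.
Proof.
have [y hy [y0 y1 _]] := square_closing (u false) (u true) x0.
have -> : u = y \o pair false by apply/funext => -[].
exact: hull_reindex hy.
Qed.

Lemma dyn_parallelograms_structure :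
  parallelogram_structure (dyn_parallelograms T).
Proof.
pose edge (a : X * X) b := if b then a.2 else a.1.
have edgeP a b : dyn_parallelograms T (a.1, a.2, b.1, b.2) <->
    hull square_exponents (glue (edge a) (edge b)).
  rewrite dyn_parallelogramsP.
  suff -> : square_of (a.1, a.2, b.1, b.2) = glue (edge a) (edge b) by [].
  by apply/funext => -[[] []].
split.
- exact: (inhabits x0).
- split=> [a|a b /edgeP ab|a b c /edgeP ab /edgeP bc]; apply/edgeP.
  + by apply: (@hull_glue_refl _ [set: bool -> int]); exact: hull_edge.
  + exact: (@hull_glue_sym _ [set: bool -> int]).
  + exact: (@hull_glue_trans _ [set: bool -> int]) ab bc.
- move=> a b c d /dyn_parallelogramsP abcd; apply/dyn_parallelogramsP.
  have -> : square_of (a, c, b, d) =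
      square_of (a, b, c, d) \o (fun cb => (cb.2, cb.1)).
    by apply/funext => -[[] []].
  apply: hull_reindex abcd => e /square_exponentsP eE.
  by apply/square_exponentsP => /=; lia.
- move=> a b c; have [y hy [<- <- <-]] := square_closing a b c.
  exists (y (true, true)); apply/dyn_parallelogramsP.
  by rewrite -/(tuple_of_square y) tuple_of_squareK.
Qed.

Lemma dyn_parallelepipeds_faces (x1 x2 x3 x4 x5 x6 x7 x8 : X) :
  let P := dyn_parallelograms T in
  dyn_parallelepipeds T ((x1, x2, x3, x4), (x5, x6, x7, x8)) ->
  [/\ P (x1, x2, x3, x4) /\ P (x5, x6, x7, x8),
      P (x1, x2, x5, x6) /\ P (x3, x4, x7, x8) &
      P (x1, x3, x5, x7) /\ P (x2, x4, x6, x8)].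
Proof.
move=> P /dyn_parallelepipedsP; set y := cube_of _ => hy.
(* Each face is a reindexing along an embedding of the square that pulls affine exponents back to
   affine ones. *)
have face (f : bool * bool -> bool * (bool * bool)) q :
    (forall e, cube_exponents e -> square_exponents (e \o f)) ->
    square_of q = y \o f -> P q.
  move=> cf yf; apply/dyn_parallelogramsP; rewrite yf.
  exact: hull_reindex hy.
split; split.
- apply: (face (fun cb => (false, cb))).
    move=> e /cube_exponentsP [? ? ? ?].
    by apply/square_exponentsP => /=; lia.
  by apply/funext => -[[] []].
- apply: (face (fun cb => (true, cb))).
    move=> e /cube_exponentsP [? ? ? ?].
    by apply/square_exponentsP => /=; lia.
  by apply/funext => -[[] []].
- apply: (face (fun cb => (cb.1, (false, cb.2)))).
    move=> e /cube_exponentsP [? ? ? ?].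
    by apply/square_exponentsP => /=; lia.
  by apply/funext => -[[] []].
- apply: (face (fun cb => (cb.1, (true, cb.2)))).
    move=> e /cube_exponentsP [? ? ? ?].
    by apply/square_exponentsP => /=; lia.
  by apply/funext => -[[] []].
- apply: (face (fun cb => (cb.1, (cb.2, false)))).
    move=> e /cube_exponentsP [? ? ? ?].
    by apply/square_exponentsP => /=; lia.
  by apply/funext => -[[] []].
- apply: (face (fun cb => (cb.1, (cb.2, true)))).
    move=> e /cube_exponentsP [? ? ? ?].
    by apply/square_exponentsP => /=; lia.
  by apply/funext => -[[] []].
Qed.

Lemma dyn_parallelepipeds_equivalence :
  RelationClasses.Equivalence
    (fun q r : {q : pow4 X | dyn_parallelograms T q} =>
      dyn_parallelepipeds T (sval q, sval r)).
Proof.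
split.
- move=> [q /= /dyn_parallelogramsP Pq]; apply/dyn_parallelepipedsP.
  exact: (@hull_glue_refl _ square_exponents).
- move=> q r /dyn_parallelepipedsP qr; apply/dyn_parallelepipedsP.
  exact: (@hull_glue_sym _ square_exponents).
- move=> q r s /dyn_parallelepipedsP qr /dyn_parallelepipedsP rs.
  apply/dyn_parallelepipedsP.
  apply: (@hull_glue_trans _ square_exponents) qr rs.
  exact: square_exponent_monoid.
Qed.

Lemma dyn_parallelepipeds_closing (x1 x2 x3 x4 x5 x6 x7 : X) :
  let P := dyn_parallelograms T in
  P (x1, x2, x3, x4) -> P (x1, x2, x5, x6) -> P (x1, x3, x5, x7) ->
  exists x8, dyn_parallelepipeds T ((x1, x2, x3, x4), (x5, x6, x7, x8)).
Proof.
move=> P /dyn_parallelogramsP P1 /dyn_parallelogramsP P2.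
move=> /dyn_parallelogramsP P3.
(* The last entry is a placeholder, since [cube_closing] prescribes nothing at 111. *)
pose w := cube_of ((x1, x2, x3, x4), (x5, x6, x7, x1)).
have [|||y hy yw] := @cube_closing w.
- by move: P1; congr hull; apply/funext => -[[] []].
- by move: P2; congr hull; apply/funext => -[[] []].
- by move: P3; congr hull; apply/funext => -[[] []].
exists (y (true, (true, true))); apply/dyn_parallelepipedsP.
move: hy; congr hull; apply/funext => -[[] [[] []]] //; exact: yw.
Qed.

Lemma dyn_parallelepipeds_permute8 (s : 'S_8) q :
  euclidean_perm R s -> dyn_parallelepipeds T q ->
  dyn_parallelepipeds T (permute8 s q).
Proof.
move=> eucl_s /dyn_parallelepipedsP hq; apply/dyn_parallelepipedsP.
have coord8E p i : coord8 p i = cube_of p (vertex_bits i).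
  move: p => [[[[? ?] ?] ?] [[[? ?] ?] ?]].
  by case: i => m; do 8![case: m => [|m] //].
(* Read on bits, [s] is a Hamming isometry, so the permuted cube is a reindexing that preserves
   affine exponents. *)
have -> : cube_of (permute8 s q) =
    cube_of q \o (fun v => vertex_bits (s (vertex_index v))).
  by apply/funext => -[[] [[] []]]; rewrite /= -coord8E.
apply: hull_reindex hq => e Ce; apply: cube_exponents_isometry => // u v.
by rewrite (euclidean_perm_hamming _ _ eucl_s) !vertex_indexK.
Qed.

End PowerActions.

Theorem mainTheorem4 (R : realType) (X : metricType R)
  (X_nonempty : [set: X] !=set0) (X_compact : compact [set: X])
  (T : homeo X) (T_minimal : minimal T) (T_distal : distal T) :
  parallelepiped_structure R (dyn_parallelograms T) (dyn_parallelepipeds T).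
Proof.
have [x0 _] := X_nonempty; split.
- exact: dyn_parallelograms_structure x0.
- exact: dyn_parallelepipeds_faces x0.
- by move=> s eucl_s q; apply: dyn_parallelepipeds_permute8 => //; exact: x0.
- exact: dyn_parallelepipeds_equivalence x0.
- exact: dyn_parallelepipeds_closing x0.
Qed.
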